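(* Let $n\ge 1$ with $\sqrt n\in\mathbb{N}$, let $\mathbf{\Psi}\in\mathbb{C}^{\sqrt n\times\sqrt n}$ be an arbitrary orthogonal transform, and let $s\in\{1,\dots,n\}$. For $k\in\{1,\dots,\sqrt n\}$ let $\mathbf{B}_k=\mathbf{\Psi}_{k,:}\otimes\mathbf{\Psi}\in\mathbb{C}^{\sqrt n\times n}$. Let $K=(k_1,\dots,k_m)\in\{1,\dots,\sqrt n\}^m$ be the indexes of the $m$ drawn blocks and let $$\mathbf{A}=\frac{1}{\sqrt m}\begin{pmatrix}\mathbf{B}_{k_1}/\sqrt{\pi_{k_1}}\\ \vdots\\ \mathbf{B}_{k_m}/\sqrt{\pi_{k_m}}\end{pmatrix}\in\mathbb{C}^{m\sqrt n\times n},$$ where $\Pi=(\pi_1,\dots,\pi_{\sqrt n})$ is a probability distribution on $\{1,\dots,\sqrt n\}$ with positive weights. If $m<\min(2s,\sqrt n)$, then there exists no decoder $\Delta$ such that $\Delta(\mathbf{A}\mathbf{x})=\mathbf{x}$ for all $s$-sparse vectors $\mathbf{x}\in\mathbb{C}^n$. In other words, the number $m$ of distinct blocks required to identify every $s$-sparse vector is necessarily at least $\min(2s,\sqrt n)$.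
   Context: $\mathbf{\Psi}_{k,:}$ is the $k$-th row of $\mathbf{\Psi}$ and $\otimes$ is the Kronecker product, so $\mathbf{B}_k=[\mathbf{\Psi}_{k,1}\mathbf{\Psi},\dots,\mathbf{\Psi}_{k,\sqrt n}\mathbf{\Psi}]$. ''Orthogonal'' for complex matrices means $\mathbf{\Psi}^*\mathbf{\Psi}=\mathrm{Id}$. A vector is $s$-sparse if its number of non-zero entries is equal to $s$. A decoder is any mapping (not necessarily linear) $\Delta:\mathbb{C}^q\to\mathbb{C}^n$, where $q=m\sqrt n$ is the number of rows of $\mathbf{A}$. *)

(* Defs.v *)
From mathcomp Require Import all_boot all_order all_algebra.
From mathcomp Require Import reals.
From mathcomp Require Export mxtens complex.

Set Implicit Arguments.
Unset Strict Implicit.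
Unset Printing Implicit Defensive.

Import Order.TTheory GRing.Theory Num.Theory.
Local Open Scope ring_scope.
Local Open Scope complex_scope.
Local Open Scope sesquilinear_scope.

(* The dimension called n in the text is N * N here, so that N is sqrt(n);
   indices run from 0, and column (j, l) of a Kronecker product with Psi has
   number j * N + l (see mxtens_index). *)

Definition orthogonal_transform (R : realType) (N : nat) (Psi : 'M[R[i]]_N) :
    Prop :=
  Psi ^t* *m Psi = 1%:M.

Definition positive_distribution (R : realType) (N : nat) (pi : 'I_N -> R) :
    Prop :=
  (forall k, 0 < pi k) /\ \sum_(k < N) pi k = 1.

(* The cast only turns the 1 * N rows given by tensmx into N rows. *)
Definition block (R : realType) (N : nat) (Psi : 'M[R[i]]_N) (k : 'I_N) :
    'M[R[i]]_(N, N * N) :=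
  castmx (mul1n N, erefl (N * N)%N) (tensmx (row k Psi) Psi).

Lemma sum_rows (m N : nat) : (\sum_(i < m) N)%N = (m * N)%N.
Proof. by rewrite sum_nat_const card_ord. Qed.

Definition sensing_matrix (R : realType) (N m : nat) (Psi : 'M[R[i]]_N)
    (pi : 'I_N -> R) (K : m.-tuple 'I_N) : 'M[R[i]]_(m * N, N * N) :=
  ((Num.sqrt m%:R)^-1 : R)%:C *:
  castmx (sum_rows m N, erefl (N * N)%N)
    (\mxcol_(i < m)
       (((Num.sqrt (pi (tnth K i)))^-1 : R)%:C *: block Psi (tnth K i))).

(* Exactly s non-zero entries, not at most s. *)
Definition sparse (R : realType) (n s : nat) (x : 'cV[R[i]]_n) : Prop :=
  #|[set i | x i ord0 != 0]| = s.

Definition identifies_sparse (R : realType) (q n s : nat) (A : 'M[R[i]]_(q, n))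
    (Delta : 'cV[R[i]]_q -> 'cV[R[i]]_n) : Prop :=
  forall x, sparse s x -> Delta (A *m x) = x.

Definition num_distinct_blocks (R : realType) (N m : nat) (Psi : 'M[R[i]]_N)
    (K : m.-tuple 'I_N) : nat :=
  size (undup [seq block Psi k | k <- K]).

(* Main.v *)
Require Import Defs.
From mathcomp Require Import all_boot all_order all_algebra.
From mathcomp Require Import reals.

(** If fewer than [min (2s, N)] distinct blocks are drawn, the corresponding
    rows of [Psi] admit a non-zero common kernel vector [u] with at most [2s]
    non-zero entries. Then [x = u ⊗ e_0] is a non-zero kernel vector of the
    sensing matrix, because [B_k x = (Psi_k u) ⊗ (Psi e_0) = 0], and it is the
    difference of two vectors with exactly [s] non-zero entries each, which no
    decoder can tell apart. *)

Import GRing.Theory Num.Theory.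
Local Open Scope ring_scope.
Local Open Scope complex_scope.
Local Open Scope sesquilinear_scope.

Definition support_set {V : nmodType} {n : nat} (x : 'cV[V]_n) : {set 'I_n} :=
  [set i | x i ord0 != 0].

Lemma exists_set_between {T : finType} {A B : {set T}} {s : nat} :
  A \subset B -> (#|A| <= s <= #|B|)%N ->
  exists P : {set T}, [/\ A \subset P, P \subset B & #|P| = s].
Proof.
move=> sAB; elim: s => [|s IHs] /andP[leAs lesB].
  by exists A; split=> //; apply/eqP; rewrite -leqn0.
have [eqAs|neqAs] := eqVneq #|A| s.+1; first by exists A.
have [|P [sAP sPB cardP]] := IHs.
  by rewrite (ltnW lesB) andbT -ltnS ltn_neqAle neqAs.
have /properP[_ [x xB xNP]] : P \proper B by rewrite properEcard sPB cardP.
exists (x |: P); split; first exact: subset_trans sAP (subsetUr _ _).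
- by rewrite subUset sub1set xB.
- by rewrite cardsU1 xNP cardP.
Qed.

(** [P] and [Q] are to be the supports of two vectors whose difference has support [A]: an index in
    just one of them must lie in [A], while one in both may lie anywhere. A small [A] is padded to
    [P = Q]; a large one is covered by two of its own subsets. *)
Lemma cover_by_two_sets {T : finType} {A : {set T}} {s : nat} :
  (#|A| <= 2 * s)%N -> (s <= #|T|)%N ->
  exists P Q : {set T},
    [/\ #|P| = s, #|Q| = s, A \subset P :|: Q & (P :\: Q) :|: (Q :\: P) \subset A].
Proof.
move=> leA2s lesT; have [leAs|/ltnW lesA] := leqP #|A| s.
  have [|P [sAP _ cardP]] := exists_set_between (subsetT A) (s := s).
    by rewrite leAs cardsT.
  by exists P, P; split; rewrite ?setUid ?setDv ?sub0set.
have [|P [_ sPA cardP]] := exists_set_between (sub0set A) (s := s).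
  by rewrite cards0 lesA.
have [|Q [sAPQ sQA cardQ]] := exists_set_between (subsetDl A P) (s := s).
  by rewrite lesA cardsDS // cardP leq_subLR addnn -mul2n leA2s.
exists P, Q; split=> //; first by rewrite -subDset.
by rewrite subUset !(subset_trans (subsetDl _ _)).
Qed.

Lemma difference_of_sparse {F : numDomainType} {n s : nat} (x : 'cV[F]_n) :
  (s <= n)%N -> (#|support_set x| <= 2 * s)%N ->
  exists y z : 'cV[F]_n,
    [/\ #|support_set y| = s, #|support_set z| = s & y - z = x].
Proof.
move=> lesn lex2s.
have [|P [Q [cardP cardQ sxPQ sPQx]]] := cover_by_two_sets lex2s (s := s).
  by rewrite card_ord.
(* With [z = y - x], the pair of entries of [y] and [z] is [(x, 0)] on [P \ Q], [(0, -x)] on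
   [Q \ P], and on the intersection [(1, 1)] or [(2x, x)] according to whether [x] vanishes there,
   so that neither entry is zero. *)
pose y : 'cV[F]_n := \col_i if i \notin P then 0
  else if i \notin Q then x i ord0
  else if x i ord0 == 0 then 1 else x i ord0 *+ 2.
exists y, (y - x); split; last by rewrite opprB addrC subrK.
- rewrite -cardP; apply: eq_card => i; rewrite !inE mxE.
  move/subsetP: sPQx => /(_ i); rewrite !inE.
  case: (i \in P); case: (i \in Q) => //= sx.
  + by case: ifP => x0; rewrite ?oner_neq0 // mulrn_eq0 x0.
  + by rewrite sx.
  + by rewrite eqxx.
  + by rewrite eqxx.
rewrite -cardQ; apply: eq_card => i; rewrite !inE !mxE.
move/subsetP: sPQx => /(_ i); move/subsetP: sxPQ => /(_ i); rewrite !inE.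
case: (i \in P); case: (i \in Q) => //= xs sx.
- by case: ifP => x0; rewrite ?(eqP x0) ?subr0 ?oner_neq0 // mulr2n addrK x0.
- by rewrite subrr eqxx.
- by rewrite sub0r oppr_eq0 sx.
- by rewrite sub0r oppr_eq0; apply/negbTE/negP=> xi0; have := xs xi0.
Qed.

(** The first [d + 1] columns of [A] are linearly dependent; the coefficients of a dependency,
    padded with zeros, form [u]. *)
Lemma sparse_kernel_vector {F : fieldType} {d n : nat} (A : 'M[F]_(d, n)) :
  (d < n)%N ->
  exists u : 'cV[F]_n, [/\ A *m u = 0, u != 0 & (#|support_set u| <= d.+1)%N].
Proof.
move=> ltdn; pose J : 'M[F]_(n, d.+1) := pid_mx d.+1.
have: kermx (A *m J)^T != 0.
  rewrite kermx_eq0 /row_free neq_ltn.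
  by rewrite (leq_ltn_trans (rank_leq_col _)).
case/rowV0Pn=> v /sub_kermxP vAJ v0; exists (J *m v^T); split.
- by apply: trmx_inj; rewrite mulmxA trmx_mul trmxK vAJ trmx0.
- apply: contra_neq v0 => Jv0.
  (* The padding map [J] has a left inverse, so it kills no non-zero vector. *)
  have: (pid_mx d.+1 : 'M[F]_(d.+1, n)) *m (J *m v^T) = 0.
    by rewrite Jv0 mulmx0.
  rewrite mulmxA pid_mx_id // pid_mx_1 mul1mx => /(congr1 trmx).
  by rewrite trmxK trmx0.
apply: leq_trans (_ : #|widen_ord ltdn @: setT| <= _)%N; last first.
  by rewrite (leq_trans (leq_imset_card _ _)) // cardsT card_ord.
apply/subset_leq_card/subsetP=> i; rewrite inE => ui.
have [ltid|ledi] := ltnP i d.+1.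
  by apply/imsetP; exists (Ordinal ltid) => //; apply: val_inj.
case/eqP: ui; rewrite mxE big1 // => j _.
by rewrite mxE [(i < _)%N]ltnNge ledi andbF mul0r.
Qed.

(** Since [Psi] is also a right inverse of its adjoint's inverse side, that is [Psi *m Psi ^t* = 1],
    multiplying block [k] on the right by the tensor square of [Psi ^t*] leaves the [k]-th unit row
    tensored with the identity, which determines [k]. *)
Lemma block_injective {R : realType} {N : nat} {Psi : 'M[R[i]]_N} :
  (0 < N)%N -> orthogonal_transform Psi -> injective (block Psi).
Proof.
move=> N_gt0 Psi_orth k k' eq_block.
have eq_tens : tensmx (row k Psi) Psi = tensmx (row k' Psi) Psi.
  have := congr1 (castmx (esym (mul1n N), erefl)) eq_block.
  by rewrite /block !castmx_comp !castmx_id.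
have PsiK := mulmx1C Psi_orth.
have := congr1 (mulmx^~ (tensmx (Psi ^t*) (Psi ^t*))) eq_tens.
rewrite /= !tensmx_mul -!row_mul PsiK => /matrixP.
pose l := Ordinal N_gt0.
move=> /(_ (mxtens_index (ord0, l)) (mxtens_index (k, l))).
rewrite !tensmxE !mxE !eqxx !mulr1.
by case: eqVneq => // _ /eqP; rewrite oner_eq0.
Qed.

Lemma sensing_matrix_kernel {R : realType} {N m : nat} {Psi : 'M[R[i]]_N}
    (pi : 'I_N -> R) {K : m.-tuple 'I_N} {x : 'cV[R[i]]_(N * N)} :
  (forall k, k \in K -> block Psi k *m x = 0) ->
  sensing_matrix Psi pi K *m x = 0.
Proof.
move=> Bx0; rewrite /sensing_matrix -scalemxAl -[x in LHS](castmx_id (erefl, erefl)).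
rewrite -castmx_mul mxcol_mul.
under eq_mxcol => i do rewrite -scalemxAl Bx0 ?mem_tnth // scaler0.
by rewrite mxcol0 [castmx _ _](_ : _ = 0) ?scaler0 // castmx_const.
Qed.

Lemma block_mul_tens {R : realType} {N : nat} (Psi : 'M[R[i]]_N)
    (k : 'I_N) (u v : 'cV[R[i]]_N) :
  row k Psi *m u = 0 -> block Psi k *m (tensmx u v : 'cV_(N * N)) = 0.
Proof.
move=> ru0; rewrite /block -[tensmx u v](castmx_id (erefl, erefl)) -castmx_mul.
by rewrite tensmx_mul ru0 tens0mx castmx_const.
Qed.

Lemma num_distinct_blocks_le {R : realType} {N m : nat} (Psi : 'M[R[i]]_N)
    (K : m.-tuple 'I_N) :
  (num_distinct_blocks Psi K <= m)%N.
Proof. by rewrite (leq_trans (size_undup _)) // size_map size_tuple. Qed.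

Theorem proposition4p5 (R : realType) (N s m : nat)
    (N_gt0 : (1 <= N)%N) (s_bounds : (1 <= s <= N * N)%N)
    (Psi : 'M[R[i]]_N) (Psi_orth : orthogonal_transform Psi)
    (pi : 'I_N -> R) (pi_distr : positive_distribution pi)
    (K : m.-tuple 'I_N) :
  ((m < minn (2 * s) N)%N ->
     ~ exists Delta : 'cV[R[i]]_(m * N) -> 'cV[R[i]]_(N * N),
         identifies_sparse s (sensing_matrix Psi pi K) Delta) /\
  ((exists Delta : 'cV[R[i]]_(m * N) -> 'cV[R[i]]_(N * N),
      identifies_sparse s (sensing_matrix Psi pi K) Delta) ->
     (minn (2 * s) N <= num_distinct_blocks Psi K)%N).
Proof.
(* The bound on distinct blocks gives the impossibility for small [m], as [m] draws yield at most
   [m] distinct blocks. *)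
suff enough_blocks : (exists Delta : 'cV[R[i]]_(m * N) -> 'cV[R[i]]_(N * N),
      identifies_sparse s (sensing_matrix Psi pi K) Delta) ->
     (minn (2 * s) N <= num_distinct_blocks Psi K)%N.
  split=> // ltm /enough_blocks.
  by rewrite leqNgt (leq_ltn_trans (num_distinct_blocks_le _ _) ltm).
case=> Delta DeltaK; rewrite leqNgt; apply/negP.
(* Counting distinct blocks amounts to counting distinct indices. *)
rewrite /num_distinct_blocks undup_map_inj ?size_map; last first.
  exact: block_injective.
set ks := undup K; rewrite leq_min => /andP[lt2s ltN].
(* [ltN] provides the kernel vector; [lt2s] turns its sparsity bound [size ks + 1] into [2 * s]. *)
have [u [ker_u u0 supp_u]] :=
  sparse_kernel_vector (\matrix_(i < size ks) row (tnth (in_tuple ks) i) Psi) ltN.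
have row_u k : k \in K -> row k Psi *m u = 0.
  rewrite -mem_undup -/ks => /(@tnthP _ _ (in_tuple ks))[i ->].
  by rewrite -(rowK (fun i => row (tnth (in_tuple ks) i) Psi)) -row_mul ker_u row0.
pose l := Ordinal N_gt0.
pose x : 'cV[R[i]]_(N * N) := tensmx u (delta_mx l ord0 : 'cV_N).
have xE i j : x (mxtens_index (i, j)) ord0 = u i ord0 *+ (j == l).
  (* The only column index must itself appear as a pair before [tensmxE] applies. *)
  transitivity (x (mxtens_index (i, j)) (mxtens_index (ord0 : 'I_1, ord0 : 'I_1))).
    by congr (x _ _); apply: val_inj.
  apply: etrans (tensmxE u (delta_mx l ord0 : 'cV_N) _ _ _ _) _.
  by rewrite mxE eqxx andbT mulr_natr.
have supp_x : (#|support_set x| <= 2 * s)%N.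
  apply: leq_trans lt2s; apply: leq_trans supp_u.
  (* Tensoring with a unit vector only moves entry [i] of [u] to position [(i, l)]. *)
  apply: leq_trans (leq_imset_card (fun i => mxtens_index (i, l)) _).
  apply/subset_leq_card/subsetP=> k; case: (mxtens_indexP k) => i j.
  rewrite inE xE; case: (eqVneq j l) => [-> ui|_]; last by rewrite eqxx.
  by apply: imset_f; rewrite inE.
have x0 : x != 0.
  apply: contra_neq u0 => x0; apply/colP=> i.
  by have := xE i l; rewrite x0 eqxx !mxE.
have ker_x : sensing_matrix Psi pi K *m x = 0.
  by apply: sensing_matrix_kernel => k /row_u; apply: block_mul_tens.
have [|y [z [sy sz yz]]] := difference_of_sparse _ _ supp_x.
  by case/andP: s_bounds.
case/eqP: x0; rewrite -yz -(DeltaK y sy) -(DeltaK z sz).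
suff -> : sensing_matrix Psi pi K *m y = sensing_matrix Psi pi K *m z.
  exact: subrr.
by apply/eqP; rewrite -subr_eq0 -mulmxBr yz ker_x.
Qed.
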